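(* Let $G$ and $H$ be binary structures in the same signature. The following are equivalent. (1) For all $i\neq i'$ in $G$ there are $j,j'\in H$ such that $\{(i,j),(i',j')\}$ is a partial homomorphism from $G$ to $H$; and every partial homomorphism $\{(i,j),(i',j')\}$ from $G$ to $H$ with $i\neq i'$ extends to a homomorphism $G\to H$. (2) The relation algebra $\mathcal B_{G,H}$ is completely representable.
   Context: A binary structure is a structure whose signature consists only of binary relation symbols. For binary structures $G,H$ in the same signature, a partial homomorphism from $G$ to $H$ is a partial map $h$ from $G$ to $H$ such that whenever $i\neq i'$ lie in the domain of $h$ and $(i,i')\in b^G$ for a relation symbol $b$, then $(h(i),h(i'))\in b^H$; a homomorphism is a total such map. The relation algebra $\mathcal B_{G,H}$ is the complex algebra of the following atom structure. Atoms: $1'$, ${\sf b}$, ${\sf w}$, ${\sf y}$, ${\sf g}_i$ ($i\in G$, the green atoms), ${\sf r}_{j,j'}$ ($j,j'\in H$, the red atoms). All atoms are self-converse except ${\sf r}_{j,j'}^\smile={\sf r}_{j',j}$. The set of forbidden triples is the closure under the maps $(a,b,c)\mapsto(a^\smile,c,b)$ and $(a,b,c)\mapsto(c,b^\smile,a)$ of the following triples: (I) $(1',a,b)$ with $a\neq b$; (II) $({\sf g}_i,{\sf g}_{i'},{\sf g}_{i''})$ and $({\sf g}_i,{\sf g}_{i'},{\sf w})$ for all $i,i',i''\in G$; (III) $({\sf y},{\sf y},{\sf y})$ and $({\sf y},{\sf y},{\sf b})$; (IV) $({\sf r}_{j_1,j_2},{\sf r}_{j_2',j_3'},{\sf r}_{j_1^*,j_3^*})$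 unless $j_1=j_1^*$, $j_2=j_2'$, $j_3'=j_3^*$; (V) $({\sf g}_i,{\sf g}_{i'},{\sf r}_{j,j'})$ unless $\{(i,j),(i',j')\}$ is a partial homomorphism from $G$ to $H$; (VI) $({\sf g}_i,{\sf g}_i,{\sf r}_{j,j'})$ for all $i\in G$, $j,j'\in H$. The complex algebra has as elements all sets of atoms, Boolean operations set-theoretic, identity $\{1'\}$, converse applied atomwise, and composition $X;Y=\{c:\exists a\in X,\ b\in Y,\ (a,b,c)\text{ not forbidden}\}$. A complete representation is a representation as an algebra of binary relations that preserves all existing (possibly infinite) sums. *)

(* Defs.v *)
From mathcomp Require Import all_boot all_order.
From mathcomp Require Import boolp classical_sets.

Set Implicit Arguments.
Unset Strict Implicit.
Unset Printing Implicit Defensive.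

Local Open Scope classical_set_scope.

Record binary_structure (L : Type) := BinaryStructure {
  carrier :> Type;
  interp : L -> set (carrier * carrier)
}.

(* Partial maps are represented by their graphs.  Loops (i, i) of [G] impose
   no condition on a partial homomorphism. *)
Definition partial_map (X Y : Type) (p : set (X * Y)) : Prop :=
  forall i j j', p (i, j) -> p (i, j') -> j = j'.

Definition partial_homomorphism (L : Type) (G H : binary_structure L)
    (p : set (G * H)) : Prop :=
  partial_map p /\
  forall (b : L) i i' j j', p (i, j) -> p (i', j') -> i <> i' ->
    interp b (i, i') -> interp b (j, j').

Definition total_map (X Y : Type) (p : set (X * Y)) : Prop :=
  forall i, exists j, p (i, j).

Definition homomorphism (L : Type) (G H : binary_structure L)
    (p : set (G * H)) : Prop :=
  partial_homomorphism p /\ total_map p.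

(* Boolean algebras with the extra operations of a relation algebra.  The
   relation algebra axioms are not part of the record: they hold automatically
   in every representable algebra, whereas the complex algebra of an arbitrary
   atom structure need not be associative. *)
Record rel_type_algebra := RelTypeAlgebra {
  ra_disp : Order.disp_t;
  ra_sort :> ctbDistrLatticeType ra_disp;
  ra_id : ra_sort;
  ra_conv : ra_sort -> ra_sort;
  ra_comp : ra_sort -> ra_sort -> ra_sort
}.

(* Complements are relative to [h \top], which need not be the full relation
   on [U]; that it is an equivalence relation on [U] follows from the other
   clauses, since every [h a] is included in it. *)
Definition representation (A : rel_type_algebra) (U : Type)
    (h : A -> set (U * U)) : Prop :=
  [/\ injective h,
      h \bot%O = set0,
      forall a b : A, h (Order.join a b) = h a `|` h b &
      forall a : A, h (Order.compl a) = h \top%O `\` h a] /\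
  [/\ h (ra_id A) = diagonal,
      forall a : A, h (ra_conv a) = (h a)^-1%relation &
      forall a b : A, h (ra_comp a b) = (h a \; h b)%relation].

Definition complete_representation (A : rel_type_algebra) (U : Type)
    (h : A -> set (U * U)) : Prop :=
  representation h /\
  forall (S : set A) (a : A), supremums S a -> h a = \bigcup_(s in S) h s.

Definition completely_representable (A : rel_type_algebra) : Prop :=
  exists (U : Type) (h : A -> set (U * U)), complete_representation h.

Definition complex_algebra (At : Type) (one : At) (cnv : At -> At)
    (forbidden : At -> At -> At -> Prop) : rel_type_algebra :=
  @RelTypeAlgebra _ (set At) [set one] (fun X => cnv @` X)
    (fun X Y => [set c | exists a b, [/\ X a, Y b & ~ forbidden a b c]]).

Inductive atom (X Y : Type) : Type :=
  | one' | black | white | yellow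
  | green of X
  | red of Y & Y.
Arguments one' {X Y}.
Arguments black {X Y}.
Arguments white {X Y}.
Arguments yellow {X Y}.
Arguments green {X Y} _.
Arguments red {X Y} _ _.

Definition atom_conv (X Y : Type) (a : atom X Y) : atom X Y :=
  if a is red j j' then red j' j else a.

Inductive forbidden (L : Type) (G H : binary_structure L) :
    atom G H -> atom G H -> atom G H -> Prop :=
  | forbidden_id a b : a <> b -> forbidden one' a b
  | forbidden_ggg i i' i'' : forbidden (green i) (green i') (green i'')
  | forbidden_ggw i i' : forbidden (green i) (green i') white
  | forbidden_yyy : forbidden yellow yellow yellow
  | forbidden_yyb : forbidden yellow yellow black
  | forbidden_rrr j1 j2 j2' j3' j1s j3s :
      ~ [/\ j1 = j1s, j2 = j2' & j3' = j3s] ->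
      forbidden (red j1 j2) (red j2' j3') (red j1s j3s)
  | forbidden_ggr i i' j j' :
      ~ partial_homomorphism [set (i, j); (i', j')] ->
      forbidden (green i) (green i') (red j j')
  | forbidden_ggr_same i j j' : forbidden (green i) (green i) (red j j')
  | forbidden_left a b c : forbidden a b c -> forbidden (atom_conv a) c b
  | forbidden_right a b c : forbidden a b c -> forbidden c (atom_conv b) a.

Definition rainbow_algebra (L : Type) (G H : binary_structure L) :
    rel_type_algebra :=
  complex_algebra one' (@atom_conv G H) (@forbidden L G H).

(* Main.v *)
(* From a complete representation: label the pairs of points by atoms.  Above
   an edge (x, y) with any label other than 1' one finds, for every k in G, a
   point z k with (x, z k) labelled g_k and (z k, y) labelled y.  The forbidden
   triples force the edges between the z k to be red with matching indices, and
   these indices form a homomorphism from G to H.  Two of the z k can be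
   prescribed together with the red edge between them.

   Conversely, a representation is a maximal labelled network.  A point z
   adjoined over an edge (x0, y0) gets, to every other point u, the label white,
   unless z and u have a common green neighbour among x0 and y0; then black,
   unless they have a common yellow neighbour there; and red otherwise.  Red
   labels are read off a homomorphism kept for each pair (x, y), which accounts
   for all red edges in its cone, the set of the u with (x, u) green and (u, y)
   yellow.  A new point joins the cone of an old pair only if that pair is
   (x0, y0) or (y0, x0), while the cone of a new pair is contained in {x0, y0},
   so that its homomorphism only has to extend a partial homomorphism on two
   points. *)
Require Import Defs.
From mathcomp Require Import all_boot all_order.
From mathcomp Require Import boolp classical_sets.

Set Implicit Arguments.
Unset Strict Implicit.
Unset Printing Implicit Defensive.

Local Open Scope classical_set_scope.

(** * Forbidden and allowed triples *)

Section ForbiddenTriples.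
Context (L : Type) (G H : binary_structure L).
Local Notation At := (atom G H).
Local Notation bad := (@forbidden L G H).

Lemma atom_convK : involutive (@atom_conv G H).
Proof. by case. Qed.

Lemma atom_conv_eq (c d : At) : atom_conv c = d -> c = atom_conv d.
Proof. by move=> <-; rewrite atom_convK. Qed.

Lemma forbidden_leftE (a b c : At) : bad (atom_conv a) c b <-> bad a b c.
Proof.
split=> [/forbidden_left|]; last exact: forbidden_left.
by rewrite atom_convK.
Qed.

Lemma forbidden_rev (a b c : At) :
  bad b (atom_conv c) (atom_conv a) <-> bad a b c.
Proof.
split=> [/forbidden_right|/forbidden_left/forbidden_right //].
by rewrite atom_convK forbidden_leftE.
Qed.

Lemma partial_homomorphism_pairC (i i' : G) (j j' : H) :
  partial_homomorphism [set (i, j); (i', j')] ->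
  partial_homomorphism [set (i', j'); (i, j)].
Proof. by rewrite setUC. Qed.

Lemma partial_homomorphism_sub (f g : set (G * H)) :
  f `<=` g -> partial_homomorphism g -> partial_homomorphism f.
Proof.
move=> fg [gf gm]; split=> [i j j' /fg g1 /fg|]; first exact: gf g1.
by move=> b i i' j j' /fg g1 /fg; exact: gm.
Qed.

Lemma partial_homomorphism_pair (f : set (G * H)) (i i' : G) (j j' : H) :
  partial_homomorphism f -> f (i, j) -> f (i', j') ->
  partial_homomorphism [set (i, j); (i', j')].
Proof. by move=> fP fij fij'; apply: partial_homomorphism_sub fP => _ [|] ->. Qed.

Lemma allowed_green_green (i i' : G) (c : At) : ~ bad (green i) (green i') c ->
  [/\ c <> white, forall k, c <> green k &
      forall j j', c = red j j' ->
        i <> i' /\ partial_homomorphism [set (i, j); (i', j')]].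
Proof.
move=> ok; split.
- by move=> cE; apply: ok; rewrite cE; apply: forbidden_ggw.
- by move=> k cE; apply: ok; rewrite cE; apply: forbidden_ggg.
- move=> j j' cE; split=> [ii'|].
  + by apply: ok; rewrite cE ii'; apply: forbidden_ggr_same.
  + by apply: contrapT => nP; apply: ok; rewrite cE; apply: forbidden_ggr.
Qed.

Lemma allowed_yellow_yellow (c : At) : ~ bad yellow yellow c ->
  c <> yellow /\ c <> black.
Proof.
move=> ok; split=> cE; apply: ok; rewrite cE.
- exact: forbidden_yyy.
- exact: forbidden_yyb.
Qed.

Lemma allowed_red_red j1 j2 j2' j3' j1s j3s :
  ~ bad (red j1 j2) (red j2' j3') (red j1s j3s) ->
  [/\ j1 = j1s, j2 = j2' & j3' = j3s].
Proof. by move=> ok; apply: contrapT => nP; apply: ok; apply: forbidden_rrr. Qed.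

Lemma allowed_one_l (a b : At) : ~ bad one' a b -> a = b.
Proof. by move=> ok; apply: contrapT => ?; apply: ok; apply: forbidden_id. Qed.

Lemma allowed_one_r (a b : At) : ~ bad a one' b -> a = b.
Proof. by move=> /forbidden_rev/allowed_one_l /(can_inj atom_convK). Qed.

Lemma allowed_one (a b : At) : ~ bad a b one' -> b = atom_conv a.
Proof. by move=> /(@forbidden_leftE a)/allowed_one_r. Qed.

(** Induction on the closure, with the three places of [one'] treated together because the closure
    maps move it around. The main use is that [(a, atom_conv a, one')] is allowed for every [a]. *)
Lemma forbidden_one (a b c : At) : bad a b c ->
  [/\ a = one' -> b <> c, b = one' -> a <> c & c = one' -> b <> atom_conv a].
Proof.
elim=> {a b c} //=; try by split.
- by move=> a b ab; split=> ? ?; apply: ab; subst.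
- by move=> [||||?|? ?] [||||?|? ?] [||||?|? ?] _ [] /= h1 h2 h3; split; move=> e1 e2;
    move: h1 h2 h3; rewrite ?e1 ?e2 //=; intuition congruence.
- by move=> [||||?|? ?] [||||?|? ?] [||||?|? ?] _ [] /= h1 h2 h3; split; move=> e1 e2;
    move: h1 h2 h3; rewrite ?e1 ?e2 //=; intuition congruence.
Qed.

Definition is_green (a : At) := if a is green _ then true else false.
Definition is_yellow (a : At) := if a is yellow then true else false.
Definition is_one (a : At) := if a is one' then true else false.

(** Apart from [forbidden_id], no generating rule mixes green and yellow. The Boolean conditions are
    symmetric in the three places and conversion preserves colours, so the closure maps keep the
    property. *)
Lemma forbidden_green_yellow (a b c : At) : bad a b c ->
  is_green a || is_green b || is_green c ->
  is_yellow a || is_yellow b || is_yellow c ->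
  is_one a || is_one b || is_one c.
Proof.
elim=> {a b c} //=.
- by case=> [||||?|? ?] [||||?|? ?] [||||?|? ?] _.
- by case=> [||||?|? ?] [||||?|? ?] [||||?|? ?] _.
Qed.

Lemma forbidden_yellow_yellow_red (a b c : At) : bad a b c ->
  match a, b, c with
  | yellow, yellow, red _ _ | yellow, red _ _, yellow
  | red _ _, yellow, yellow => False
  | _, _, _ => True
  end.
Proof.
elim=> {a b c} //=.
- by case=> [||||?|? ?] [||||?|? ?] [||||?|? ?] _.
- by case=> [||||?|? ?] [||||?|? ?] [||||?|? ?] _.
Qed.

(** The three patterns are one triangle with its red edge in each of the three places. Reversing the
    red edge swaps the two pairs, hence the [setUC]. *)
Lemma forbidden_green_green_red (a b c : At) : bad a b c ->
  match a, b, c with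
  | green i, green i', red j j' | green i, red j j', green i'
  | red j j', green i', green i =>
      i = i' \/ ~ partial_homomorphism [set (i, j); (i', j')]
  | _, _, _ => True
  end.
Proof.
elim=> {a b c} //=; try by [left|right].
- by case=> [||||?|? ?] [||||?|? ?] [||||?|? ?] _ //=; rewrite setUC;
    intuition.
- by case=> [||||?|? ?] [||||?|? ?] [||||?|? ?] _ //=; rewrite setUC;
    intuition.
Qed.

End ForbiddenTriples.

(** * Labelled networks *)

Section Networks.
Context (L : Type) (G H : binary_structure L) (T : Type).
Local Notation At := (atom G H).
Local Notation bad := (@forbidden L G H).
Implicit Types (D : set T) (lab : T -> T -> At) (F : T -> T -> set (G * H)).

Definition consistent D lab :=
  [/\ forall x y, D x -> D y -> lab x y = one' <-> x = y,
      forall x y, D x -> D y -> lab y x = atom_conv (lab x y) &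
      forall x y w, D x -> D y -> D w ->
        ~ bad (lab x y) (lab y w) (lab x w)].

(** The two closure maps merely list the vertices of a triangle in another order, so it suffices to
    exclude the generating triples on all triangles. *)
Lemma consistent_intro D lab :
  (forall x y, D x -> D y -> lab x y = one' <-> x = y) ->
  (forall x y, D x -> D y -> lab y x = atom_conv (lab x y)) ->
  (forall x y w i i', D x -> D y -> D w ->
     lab x y = green i -> lab y w = green i' ->
     lab x w <> white /\ forall k, lab x w <> green k) ->
  (forall x y w, D x -> D y -> D w -> lab x y = yellow -> lab y w = yellow ->
     lab x w <> yellow /\ lab x w <> black) ->
  (forall x y w j1 j2 j2' j3' j1s j3s, D x -> D y -> D w ->
     lab x y = red j1 j2 -> lab y w = red j2' j3' -> lab x w = red j1s j3s ->
     [/\ j1 = j1s, j2 = j2' & j3' = j3s]) ->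
  (forall x y w i i' j j', D x -> D y -> D w ->
     lab x y = green i -> lab y w = green i' -> lab x w = red j j' ->
     i <> i' /\ partial_homomorphism [set (i, j); (i', j')]) ->
  consistent D lab.
Proof.
move=> h1 hc hg hy hr hgr; split=> //.
(* The points are quantified inside the induction: the induction hypothesis is applied to the same
   three points reordered. *)
suff key a b c : bad a b c -> forall x y w, D x -> D y -> D w ->
    lab x y = a -> lab y w = b -> lab x w = c -> False.
  by move=> x y w Dx Dy Dw /key /(_ x y w Dx Dy Dw); apply.
elim=> {a b c}.
- move=> a b ab x y w Dx Dy Dw /(h1 _ _ Dx Dy) xy; subst y.
  by move=> -> ?; apply: ab.
- move=> i i' i'' x y w Dx Dy Dw e1 e2 e3.
  by have [_] := hg _ _ _ _ _ Dx Dy Dw e1 e2; apply; exact: e3.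
- move=> i i' x y w Dx Dy Dw e1 e2 e3.
  by have [] := hg _ _ _ _ _ Dx Dy Dw e1 e2.
- move=> x y w Dx Dy Dw e1 e2 e3.
  by have [] := hy _ _ _ Dx Dy Dw e1 e2.
- move=> x y w Dx Dy Dw e1 e2 e3.
  by have [] := hy _ _ _ Dx Dy Dw e1 e2.
- move=> j1 j2 j2' j3' j1s j3s nP x y w Dx Dy Dw e1 e2 e3.
  exact/nP/(hr _ _ _ _ _ _ _ _ _ Dx Dy Dw e1 e2 e3).
- move=> i i' j j' nP x y w Dx Dy Dw e1 e2 e3.
  by have [] := hgr _ _ _ _ _ _ _ Dx Dy Dw e1 e2 e3.
- move=> i j j' x y w Dx Dy Dw e1 e2 e3.
  by have [] := hgr _ _ _ _ _ _ _ Dx Dy Dw e1 e2 e3.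
- move=> a b c _ IH x y w Dx Dy Dw e1 e2 e3.
  by apply: (IH y x w) => //; rewrite (hc x y) // e1 atom_convK.
- move=> a b c _ IH x y w Dx Dy Dw e1 e2 e3.
  by apply: (IH x w y) => //; rewrite (hc y w) // e2 atom_convK.
Qed.

Definition in_cone lab x y i u := lab x u = green i /\ lab u y = yellow.

Definition coherent D lab F := forall x y u u' i i',
  D x -> D y -> D u -> D u' -> in_cone lab x y i u -> in_cone lab x y i' u' ->
  u <> u' -> exists j j', [/\ F x y (i, j), F x y (i', j') & lab u u' = red j j'].

(* When [G] has at most one point no condition is imposed: cones then have at
   most one point, and there may be no homomorphism at all. *)
Definition admissible (f : set (G * H)) :=
  forall i i' : G, i <> i' -> homomorphism f.

Definition network D lab F :=
  [/\ consistent D lab, forall x y, D x -> D y -> admissible (F x y) &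
      coherent D lab F].

(** Two green edges at [x] exclude white and green, two yellow edges at [y] exclude yellow and
    black, and [u <> u'] excludes [one']. Only red is left. *)
Lemma cone_red D lab x y u u' i i' : consistent D lab ->
  D x -> D y -> D u -> D u' -> in_cone lab x y i u -> in_cone lab x y i' u' ->
  u <> u' -> exists j j', [/\ lab u u' = red j j', i <> i' &
    partial_homomorphism [set (i, j); (i', j')]].
Proof.
move=> [h1 hc hb] Dx Dy Du Du' [xu uy] [xu' uy'] uu'.
have ux : lab u x = green i by rewrite (hc x u) // xu.
have yu' : lab y u' = yellow by rewrite (hc u' y) // uy'.
have := hb _ _ _ Du Dx Du'; rewrite ux xu' => /allowed_green_green [nw ng nr].
have := hb _ _ _ Du Dy Du'; rewrite uy yu' => /allowed_yellow_yellow [ny nb].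
case E : (lab u u') nw ng nr ny nb => [||||k|j j'] // nw ng nr ny nb.
- by case: uu'; apply/h1.
- by case: (ng k).
- by exists j, j'; have [] := nr j j' erefl.
Qed.

Lemma adjoin_label D lab z (p : T -> At) : ~ D z ->
  exists lab', [/\ lab' z z = one', forall u, D u -> lab' z u = p u,
    forall u, D u -> lab' u z = atom_conv (p u) &
    forall u v, D u -> D v -> lab' u v = lab u v].
Proof.
move=> nDz.
exists (fun x y => if pselect (x = z) then if pselect (y = z) then one' else p y
  else if pselect (y = z) then atom_conv (p x) else lab x y).
have neq u : D u -> u <> z by move=> Du uz; apply: nDz; rewrite -uz.
split=> [|u /neq uz|u /neq uz|u v /neq uz /neq vz];
  by do ?[case: pselect => //= ?].
Qed.

(** * One-point extension of a network *)

Section Extension.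
Context (D : set T) (lab : T -> T -> At) (F : T -> T -> set (G * H)).
Context (x0 y0 : T) (a b : At).
Hypothesis pair_exists : forall i i' : G, i <> i' ->
  exists j j' : H, partial_homomorphism [set (i, j); (i', j')].
Hypothesis pair_extends : forall (i i' : G) (j j' : H), i <> i' ->
  partial_homomorphism [set (i, j); (i', j')] ->
  exists f : set (G * H), homomorphism f /\ [set (i, j); (i', j')] `<=` f.
Hypothesis netD : network D lab F.
Hypotheses (Dx0 : D x0) (Dy0 : D y0).
Hypothesis allowed_ab : ~ bad a b (lab x0 y0).
Hypothesis no_witness : forall u, D u -> lab x0 u = a -> lab u y0 <> b.

Let C : set T := [set x0; y0].

Let CD u : C u -> D u. Proof. by case=> ->. Qed.

(** Each colour comes with the reason for choosing it. In the red case the new point enters the cone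
    of [(v, w)] with index [i], where [u] already lies with index [i'], so coherence dictates the
    label read off [F v w]. *)
Definition new_label_spec (p : T -> At) u (q : At) :=
  [\/ q = white /\ (forall v i i', C v -> p v = green i -> lab v u <> green i'),
      q = black /\ (forall v, C v -> p v = yellow -> lab v u <> yellow) |
      exists v w i i' j j',
        [/\ C v, C w, p v = green i, p w = yellow & i <> i'] /\
        [/\ in_cone lab v w i' u, F v w (i, j), F v w (i', j') & q = red j j']].

Lemma new_labels : exists p : T -> At,
  [/\ p x0 = atom_conv a, p y0 = b &
      forall u, D u -> ~ C u -> new_label_spec p u (p u)].
Proof.
have [[h1 hc hb] hF _] := netD.
pose p0 u := if pselect (u = x0) then atom_conv a else b.
have p0x : p0 x0 = atom_conv a by rewrite /p0; case: pselect.
(* If [x0 = y0], that edge is labelled [one'], and [allowed_ab] makes the two prescribed labels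
   agree. *)
have p0y : p0 y0 = b.
  rewrite /p0; case: pselect => //= xy.
  by apply/esym/allowed_one; rewrite -(h1 x0 y0 Dx0 Dy0).2.
have /choice[q qP] : forall u, exists q, D u -> ~ C u -> new_label_spec p0 u q.
  move=> u; have [Du|] := pselect (D u); last by exists white.
  have [[v [i [i' [Cv pv vu]]]]|nG] := pselect (exists v i i',
      [/\ C v, p0 v = green i & lab v u = green i']); last first.
    exists white => _ _; apply: Or31; split=> // v i i' Cv pv vu.
    by apply: nG; exists v, i, i'.
  have [[w [Cw pw wu]]|nY] := pselect (exists w,
      [/\ C w, p0 w = yellow & lab w u = yellow]); last first.
    exists black => _ _; apply: Or32; split=> // w Cw pw wu.
    by apply: nY; exists w.
  have uw : lab u w = yellow by rewrite (hc w u) ?wu//; exact: CD.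
  (* With [i = i'], the point [u] would already be a witness for [a] and [b]. Distinct indices also
     make [F v w] a homomorphism, hence total. *)
  have ii' : i <> i'.
    move=> ii'; subst i'; case: Cv pv vu => ->; case: Cw pw wu uw => ->;
      rewrite ?p0x ?p0y => pw wu uw pv vu; try congruence.
    - apply: (no_witness Du); last by rewrite pw.
      by rewrite vu -(atom_convK a) pv.
    - apply: (no_witness Du); first by rewrite (hc u) ?uw// -(atom_convK a) pw.
      by rewrite pv (hc y0 u) // vu.
  have [fP ftot] := hF _ _ (CD Cv) (CD Cw) _ _ ii'.
  have [[j Fj] [j' Fj']] := (ftot i, ftot i').
  by exists (red j j') => _ _; apply: Or33; exists v, w, i, i', j, j'.
exists (fun u => if pselect (C u) then p0 u else q u).
have pC u : C u -> (if pselect (C u) then p0 u else q u) = p0 u.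
  by move=> Cu; case: pselect.
split; [by rewrite pC //; left|by rewrite pC //; right|].
move=> u Du nCu; case: pselect => //= _.
have [[-> h]|[-> h]|] := qP u Du nCu.
- by apply: Or31; split=> // v i i' Cv; rewrite pC //; exact: h.
- by apply: Or32; split=> // v Cv; rewrite pC //; exact: h.
- move=> [v [w [i [i' [j [j' [[Cv Cw pv pw ii'] h]]]]]]].
  by apply: Or33; exists v, w, i, i', j, j'; rewrite !pC.
Qed.

(** * Consistency and coherence at the new point *)

Section NewLabels.
Context (p : T -> At).
Hypotheses (px : p x0 = atom_conv a) (py : p y0 = b).
Hypothesis pnew : forall u, D u -> ~ C u -> new_label_spec p u (p u).

Lemma new_base_allowed u v : C u -> C v -> u <> v -> ~ bad (p u) (lab u v) (p v).
Proof.
have [[_ hc _] _ _] := netD.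
move=> [->|->] [->|->] uv; rewrite ?px ?py; try by case: uv.
- by rewrite forbidden_leftE.
- by rewrite (hc x0 y0) // forbidden_rev.
Qed.

Lemma new_apex_allowed u v : C u -> C v -> u <> v ->
  ~ bad (atom_conv (p u)) (p v) (lab u v).
Proof. by move=> Cu Cv uv; rewrite forbidden_leftE; exact: new_base_allowed. Qed.

(** If [a] were [one'], then [b] would be the label of [(x0, y0)] and [x0] itself would be a
    witness; symmetrically [y0] if [b] were [one']. *)
Lemma new_one u : D u -> p u <> one'.
Proof.
have [[h1 hc _] _ _] := netD.
move=> Du pu; have [[uE|uE]|nC] := pselect (C u).
- have a1 : a = one' by rewrite -(atom_convK a) -px -uE pu.
  move: allowed_ab; rewrite a1 => /allowed_one_l bE.
  by apply: (no_witness Dx0) => //; rewrite a1; apply/h1.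
- have b1 : b = one' by rewrite -py -uE pu.
  move: allowed_ab; rewrite b1 => /allowed_one_r aE.
  by apply: (no_witness Dy0) => //; rewrite b1; apply/h1.
- by have [[]|[]|] := pnew Du nC; rewrite pu // => -[? [? [? [? [? [? [_ []]]]]]]].
Qed.

Lemma new_green u i : D u -> p u = green i -> C u.
Proof.
move=> Du pu; apply: contrapT => nC.
by have [[]|[]|] := pnew Du nC; rewrite pu // => -[? [? [? [? [? [? [_ []]]]]]]].
Qed.

Lemma new_yellow u : D u -> p u = yellow -> C u.
Proof.
move=> Du pu; apply: contrapT => nC.
by have [[]|[]|] := pnew Du nC; rewrite pu // => -[? [? [? [? [? [? [_ []]]]]]]].
Qed.

Lemma new_white u v i i' : D u -> ~ C u -> C v -> p v = green i ->
  lab v u = green i' -> p u <> white.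
Proof.
move=> Du nC Cv pv vu pu.
have [[_ h]|[pb _]|[? [? [? [? [? [? [_ [_ _ _ pr]]]]]]]]] := pnew Du nC.
- exact: (h v i i').
- by rewrite pb in pu.
- by rewrite pr in pu.
Qed.

Lemma new_black u v : D u -> ~ C u -> C v -> p v = yellow ->
  lab v u = yellow -> p u <> black.
Proof.
move=> Du nC Cv pv vu pu.
have [[pw _]|[_ h]|[? [? [? [? [? [? [_ [_ _ _ pr]]]]]]]]] := pnew Du nC.
- by rewrite pw in pu.
- exact: (h v).
- by rewrite pr in pu.
Qed.

Lemma new_red u j j' : D u -> ~ C u -> p u = red j j' ->
  exists v w i i',
    [/\ C v, C w, p v = green i, p w = yellow & i <> i'] /\
    [/\ in_cone lab v w i' u, F v w (i, j) & F v w (i', j')].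
Proof.
move=> Du nC pu.
have [[pw _]|[pb _]|] := pnew Du nC; [by rewrite pw in pu|by rewrite pb in pu|].
move=> [v [w [i [i' [k [k' [h [ic Fk Fk' pr]]]]]]]].
by move: pr; rewrite pu => -[-> ->]; exists v, w, i, i'.
Qed.

Lemma base_pair v w u : C v -> C w -> v <> w -> C u -> u = v \/ u = w.
Proof. by move=> [->|->] [->|->] // _ [->|->]; auto. Qed.

Lemma new_cone_base v w i u : C v -> C w -> p v = green i -> p w = yellow ->
  p u <> green i -> p u <> yellow -> ~ C u.
Proof.
move=> Cv Cw pv pw pg pY Cu.
have vw : v <> w by move=> vw; move: pw; rewrite -vw pv.
by have [uE|uE] := base_pair Cv Cw vw Cu; subst u.
Qed.

(** A red label towards a point outside [C] requires the two base labels to be green and yellow, so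
    the case of exactly one of [u], [v] in [C] is impossible. If both lie outside, they belong to
    the same cone, and all three red labels are read off one function [F s t]. *)
Lemma new_red_triangle u v j1 j2 j2' j3' j1s j3s : D u -> D v ->
  p u = red j1 j2 -> lab u v = red j2' j3' -> p v = red j1s j3s ->
  [/\ j1 = j1s, j2 = j2' & j3' = j3s].
Proof.
have [[h1 hc hb] hF hcoh] := netD.
move=> Du Dv pu uv pv.
have nuv : u <> v by move/(h1 _ _ Du Dv); rewrite uv.
have [Cu|nCu] := pselect (C u); have [Cv|nCv] := pselect (C v).
- by have := new_base_allowed Cu Cv nuv; rewrite pu uv pv => /allowed_red_red.
- have [s [t [i [i' [[Cs Ct ps pt _] _]]]]] := new_red Dv nCv pv.
  by case: (new_cone_base Cs Ct ps pt _ _ Cu); rewrite pu.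
- have [s [t [i [i' [[Cs Ct ps pt _] _]]]]] := new_red Du nCu pu.
  by case: (new_cone_base Cs Ct ps pt _ _ Cv); rewrite pv.
- have [s [t [i [i' [[Cs Ct ps pt _] [ucone F1 F2]]]]]] := new_red Du nCu pu.
  have [s' [t' [k [k' [[Cs' Ct' ps' pt' _] [vcone F1' F2']]]]]] := new_red Dv nCv pv.
  have st : s <> t by move=> e; move: pt; rewrite -e ps.
  have es : s' = s.
    by have [//|e] := base_pair Cs Ct st Cs'; move: ps'; rewrite e pt.
  have et : t' = t.
    by have [e|//] := base_pair Cs Ct st Ct'; move: pt'; rewrite e ps.
  subst s' t'.
  have [l [l' [Fl Fl' uvE]]] :=
    hcoh _ _ _ _ _ _ (CD Cs) (CD Ct) Du Dv ucone vcone nuv.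
  move: ps'; rewrite ps => -[ik]; subst k.
  move: uvE; rewrite uv => -[? ?]; subst l l'.
  have ii' : i' <> k'.
    by have [_ [_ [_ + _]]] :=
      cone_red (And3 h1 hc hb) (CD Cs) (CD Ct) Du Dv ucone vcone nuv.
  have [[Ff _] _] := hF _ _ (CD Cs) (CD Ct) _ _ ii'.
  by split; [exact: Ff F1 F1'|exact: Ff F2 Fl|exact: Ff Fl' F2'].
Qed.

(** For [v] outside [C], its red label comes from a cone whose green base point must be [u]. Both
    pairs then lie in the homomorphism of that cone. *)
Lemma new_green_green_red u v i i' j j' : D u -> D v ->
  p u = green i -> lab u v = green i' -> p v = red j j' ->
  i <> i' /\ partial_homomorphism [set (i, j); (i', j')].
Proof.
have [[h1 hc hb] hF hcoh] := netD.
move=> Du Dv pu uv pv.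
have nuv : u <> v by move/(h1 _ _ Du Dv); rewrite uv.
have Cu := new_green Du pu.
have [Cv|nCv] := pselect (C v).
  have := new_base_allowed Cu Cv nuv.
  by rewrite pu uv pv => /allowed_green_green [_ _ /(_ _ _ erefl)].
have [s [t [k [k' [[Cs Ct ps pt kk'] [[sv vt] F1 F2]]]]]] := new_red Dv nCv pv.
have st : s <> t by move=> e; move: pt; rewrite -e ps.
have [e|e] := base_pair Cs Ct st Cu; last by move: pu; rewrite e pt.
subst u; move: ps kk' F1 F2; rewrite pu => -[<-].
move: sv; rewrite uv => -[<-] kk' F1 F2; split=> //.
have [fP _] := hF _ _ (CD Cs) (CD Ct) _ _ kk'.
exact: partial_homomorphism_pair fP F1 F2.
Qed.

Lemma new_green_apex u v i i' : D u -> D v ->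
  p u = green i -> p v = green i' ->
  [/\ lab u v <> white, forall k, lab u v <> green k &
      forall j j', lab u v = red j j' ->
        i <> i' /\ partial_homomorphism [set (i, j); (i', j')]].
Proof.
have [[h1 hc hb] hF hcoh] := netD.
move=> Du Dv pu pv; have [->|uv] := pselect (u = v).
  by rewrite (h1 v v Dv Dv).2.
have := new_apex_allowed (new_green Du pu) (new_green Dv pv) uv.
by rewrite pu pv => /allowed_green_green.
Qed.

Lemma new_yellow_apex u v : D u -> D v -> p u = yellow -> p v = yellow ->
  lab u v <> yellow /\ lab u v <> black.
Proof.
have [[h1 hc hb] hF hcoh] := netD.
move=> Du Dv pu pv; have [->|uv] := pselect (u = v).
  by rewrite (h1 v v Dv Dv).2.
have := new_apex_allowed (new_yellow Du pu) (new_yellow Dv pv) uv.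
by rewrite pu pv => /allowed_yellow_yellow.
Qed.

Lemma new_green_base u v i i' : D u -> D v ->
  p u = green i -> lab u v = green i' ->
  p v <> white /\ forall k, p v <> green k.
Proof.
have [[h1 hc hb] hF hcoh] := netD.
move=> Du Dv pu uv.
have nuv : u <> v by move/(h1 _ _ Du Dv); rewrite uv.
have Cu := new_green Du pu.
have [Cv|nCv] := pselect (C v).
  have := new_base_allowed Cu Cv nuv.
  by rewrite pu uv => /allowed_green_green [].
by split=> [|k /(new_green Dv)//]; exact: (new_white Dv nCv Cu pu uv).
Qed.

Lemma new_yellow_base u v : D u -> D v -> p u = yellow -> lab u v = yellow ->
  p v <> yellow /\ p v <> black.
Proof.
have [[h1 hc hb] hF hcoh] := netD.
move=> Du Dv pu uv.
have nuv : u <> v by move/(h1 _ _ Du Dv); rewrite uv.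
have Cu := new_yellow Du pu.
have [Cv|nCv] := pselect (C v).
  have := new_base_allowed Cu Cv nuv.
  by rewrite pu uv => /allowed_yellow_yellow [].
by split=> [/(new_yellow Dv)//|]; exact: (new_black Dv nCv Cu pu uv).
Qed.

Context (z : T) (lab' : T -> T -> At).
Hypotheses (Dz : ~ D z) (lzz : lab' z z = one').
Hypotheses (lz : forall u, D u -> lab' z u = p u)
  (lz' : forall u, D u -> lab' u z = atom_conv (p u))
  (lD : forall u v, D u -> D v -> lab' u v = lab u v).

Let D' : set T := D `|` [set z].

(** Triangles are sorted by the vertices equal to the new point. If it occurs more than once, some
    edge is labelled [one'] and the goal is trivial; this leaves one old triangle and three
    positions of [z]. *)
Lemma new_consistent : consistent D' lab'.
Proof.
have [[h1 hc hb] _ _] := netD.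
apply: consistent_intro.
- move=> x y [Dx|->] [Dy|->]; rewrite ?lzz ?lz' ?lz ?lD //.
  + exact: h1.
  + split=> [/atom_conv_eq/new_one|xz]; first exact.
    by case: Dz; rewrite -xz.
  + split=> [/new_one|xz]; first exact.
    by case: Dz; rewrite xz.
- move=> x y [Dx|->] [Dy|->]; rewrite ?lzz ?lz' ?lz ?lD //; first exact: hc.
  by rewrite atom_convK.
- move=> x y w i i' [Dx|->] [Dy|->] [Dw|->];
    rewrite ?lzz ?lz' ?lz ?lD // => e1 e2.
  + by have := hb _ _ _ Dx Dy Dw; rewrite e1 e2 => /allowed_green_green [].
  + have yx : lab y x = green i by rewrite (hc x y) // e1.
    have [nw ng] := new_green_base Dy Dx (atom_conv_eq e2) yx.
    by split=> [/atom_conv_eq|k /atom_conv_eq]; [exact: nw|exact: ng].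
  + by have [] := new_green_apex Dx Dw (atom_conv_eq e1) e2.
  + exact: (new_green_base Dy Dw e1 e2).
- move=> x y w [Dx|->] [Dy|->] [Dw|->];
    rewrite ?lzz ?lz' ?lz ?lD // => e1 e2.
  + by have := hb _ _ _ Dx Dy Dw; rewrite e1 e2 => /allowed_yellow_yellow [].
  + have yx : lab y x = yellow by rewrite (hc x y) // e1.
    have [ny nb] := new_yellow_base Dy Dx (atom_conv_eq e2) yx.
    by split=> /atom_conv_eq; [exact: ny|exact: nb].
  + exact: (new_yellow_apex Dx Dw (atom_conv_eq e1) e2).
  + exact: (new_yellow_base Dy Dw e1 e2).
- move=> x y w j1 j2 j2' j3' j1s j3s [Dx|->] [Dy|->] [Dw|->];
    rewrite ?lzz ?lz' ?lz ?lD // => e1 e2 e3.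
  + by have := hb _ _ _ Dx Dy Dw; rewrite e1 e2 e3 => /allowed_red_red.
  + by have [-> -> ->] :=
      new_red_triangle Dx Dy (atom_conv_eq e3) e1 (atom_conv_eq e2).
  + by have [-> -> ->] := new_red_triangle Dx Dw (atom_conv_eq e1) e3 e2.
  + exact: (new_red_triangle Dy Dw e1 e2 e3).
- move=> x y w i i' j j' [Dx|->] [Dy|->] [Dw|->];
    rewrite ?lzz ?lz' ?lz ?lD // => e1 e2 e3.
  + have := hb _ _ _ Dx Dy Dw.
    by rewrite e1 e2 e3 => /allowed_green_green [_ _ /(_ _ _ erefl)].
  + have yx : lab y x = green i by rewrite (hc x y) // e1.
    have [ii' P] := new_green_green_red Dy Dx (atom_conv_eq e2) yx (atom_conv_eq e3).
    by split; [exact/nesym|exact: partial_homomorphism_pairC].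
  + by have [_ _] := new_green_apex Dx Dw (atom_conv_eq e1) e2; apply.
  + exact: (new_green_green_red Dy Dw e1 e2 e3).
Qed.

(** Coherence of an old cone that [z] joins: [x] and [y] are common green and yellow neighbours of
    [z] and [u], which rules out white and black for [u] and leaves the label read off [F x y]. *)
Lemma new_cone_red x y u i i' : C x -> C y -> p x = green i -> p y = yellow ->
  D u -> in_cone lab x y i' u ->
  exists j j', [/\ F x y (i, j), F x y (i', j') & p u = red j j'].
Proof.
have [[h1 hc _] _ _] := netD.
move=> Cx Cy xi yy Du [xu uy].
have yu : lab y u = yellow by rewrite (hc u y) ?uy //; exact: CD.
have xy : x <> y by move=> e; move: yy; rewrite -e xi.
have nC : ~ C u.
  move=> Cu; have [e|e] := base_pair Cx Cy xy Cu; subst u.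
  - by move: xu; rewrite (h1 x x Du Du).2.
  - by move: yu; rewrite (h1 y y Du Du).2.
have nw := new_white Du nC Cx xi xu.
have nb := new_black Du nC Cy yy yu.
have [[//]|[//]|[v [w [k [k' [j [j' [[Cv Cw pv pw kk']]]]]]]]] := pnew Du nC.
have [e|e] := base_pair Cx Cy xy Cv; last by move: pv; rewrite e yy.
have [e'|e'] := base_pair Cx Cy xy Cw; first by move: pw; rewrite e' xi.
subst v w; move: pv; rewrite xi => -[<-] [[xu' _] Fj Fj' pu].
by move: xu' Fj'; rewrite xu => -[<-] Fj'; exists j, j'.
Qed.

Lemma exists_admissible : exists f : set (G * H), admissible f.
Proof.
have [[i [i' ii']]|nG] := pselect (exists i i' : G, i <> i').
  have [j [j' /(pair_extends ii') [f [hf _]]]] := pair_exists ii'.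
  by exists f.
by exists set0 => i i' ii'; case: nG; exists i, i'.
Qed.

Definition cone_good (f : set (G * H)) x y := forall u u' i i', D' u -> D' u' ->
  in_cone lab' x y i u -> in_cone lab' x y i' u' -> u <> u' ->
  exists j j', [/\ f (i, j), f (i', j') & lab' u u' = red j j'].

Lemma fresh_cone x y u i : x = z \/ y = z -> D' u -> in_cone lab' x y i u -> C u.
Proof.
move=> [->|->] [Du|->] [].
- by rewrite lz // => /(new_green Du).
- by rewrite lzz.
- by rewrite lz' // => _ /atom_conv_eq /(new_yellow Du).
- by rewrite lzz.
Qed.

(** By [fresh_cone] the cone has at most two points. If it has two, the red edge between them names
    the partial homomorphism to extend, and the only other pair to check is its reversal. *)
Lemma fresh_pair x y : D' x -> D' y -> x = z \/ y = z ->
  exists f : set (G * H), admissible f /\ cone_good f x y.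
Proof.
move=> Dx Dy xyz; have cons := new_consistent; have [_ hc _] := cons.
have [[u [u' [i [i' [Du Du' [cu cu' uu']]]]]]|nP] := pselect (exists u u' i i',
  [/\ D' u, D' u' & [/\ in_cone lab' x y i u, in_cone lab' x y i' u' & u <> u']]);
  last first.
  have [f hf] := exists_admissible; exists f; split=> // u u' i i' Du Du' cu cu' uu'.
  by case: nP; exists u, u', i, i'.
have [j [j' [uu'E ii' /(pair_extends ii') [f [hf sf]]]]] :=
  cone_red cons Dx Dy Du Du' cu cu' uu'.
have fj : f (i, j) by apply: sf; left.
have fj' : f (i', j') by apply: sf; right.
have cone_eq v k k' : in_cone lab' x y k v -> in_cone lab' x y k' v -> k = k'.
  by move=> [e _] [e' _]; move: e'; rewrite e => -[].
have [Cu Cu'] := (fresh_cone xyz Du cu, fresh_cone xyz Du' cu').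
exists f; split=> // v v' k k' Dv Dv' cv cv' vv'.
have := base_pair Cu Cu' uu' (fresh_cone xyz Dv' cv').
have := base_pair Cu Cu' uu' (fresh_cone xyz Dv cv).
move=> [?|?] [?|?]; subst v v' => //.
- by rewrite (cone_eq _ _ _ cv cu) (cone_eq _ _ _ cv' cu'); exists j, j'.
- rewrite (cone_eq _ _ _ cv cu') (cone_eq _ _ _ cv' cu); exists j', j.
  by rewrite (hc u u') // uu'E.
Qed.

Lemma new_network : exists F', network D' lab' F' /\
  forall x y, D x -> D y -> F' x y = F x y.
Proof.
have cons := new_consistent; have [_ hF hcoh] := netD.
(* Old pairs keep their homomorphism, pairs containing [z] get one from [fresh_pair], and [set0] is
   a default for pairs outside [D']. *)
have : forall xy : T * T, exists f : set (G * H),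
    (D xy.1 -> D xy.2 -> f = F xy.1 xy.2) /\
    (D' xy.1 -> D' xy.2 -> ~ (D xy.1 /\ D xy.2) ->
       admissible f /\ cone_good f xy.1 xy.2).
  move=> [x y] /=; have [[Dx Dy]|nD] := pselect (D x /\ D y).
    by exists (F x y); split=> // _ _ [].
  have [[Dx Dy]|nD'] := pselect (D' x /\ D' y).
    have xyz : x = z \/ y = z.
      by case: Dx => [Dx|]; [case: Dy => [Dy|]|]; [case: nD|right|left].
    have [f hf] := fresh_pair Dx Dy xyz.
    by exists f; split=> // Dx' Dy'; case: nD.
  exists set0; split=> Dx Dy; first by case: nD.
  by case: nD'.
move=> /choice [F0 F0P]; exists (fun x y => F0 (x, y)).
have FD x y : D x -> D y -> F0 (x, y) = F x y by apply: (F0P (x, y)).1.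
split; last by [].
split=> //.
  move=> x y Dx Dy; have [[? ?]|nD] := pselect (D x /\ D y).
    by rewrite FD //; exact: hF.
  by have [] := (F0P (x, y)).2 Dx Dy nD.
move=> x y u u' i i' Dx Dy Du Du' cu cu' uu'.
have [[Dx' Dy']|nD] := pselect (D x /\ D y); last first.
  have [_ cg] := (F0P (x, y)).2 Dx Dy nD.
  exact: cg Du Du' cu cu' uu'.
rewrite FD //.
have zC k : in_cone lab' x y k z -> [/\ C x, C y, p x = green k & p y = yellow].
  move=> []; rewrite lz // lz' // => /atom_conv_eq xk yk.
  by split=> //; [exact: (new_green _ xk)|exact: (new_yellow _ yk)].
have oldcone k v : D v -> in_cone lab' x y k v -> in_cone lab x y k v.
  by move=> Dv []; rewrite !lD.
case: Du => [Du|/= uz]; case: Du' => [Du'|/= uz'].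
- have [j [j' [Fj Fj' E]]] := hcoh _ _ _ _ _ _ Dx' Dy' Du Du' (oldcone _ _ Du cu)
    (oldcone _ _ Du' cu') uu'.
  by exists j, j'; rewrite lD.
- subst u'; have [Cx Cy px' py'] := zC _ cu'.
  have [j [j' [Fj Fj' E]]] := new_cone_red Cx Cy px' py' Du (oldcone _ _ Du cu).
  by exists j', j; rewrite lz' // E.
- subst u; have [Cx Cy px' py'] := zC _ cu.
  have [j [j' [Fj Fj' E]]] := new_cone_red Cx Cy px' py' Du' (oldcone _ _ Du' cu').
  by exists j, j'; rewrite lz.
- by case: uu'; rewrite uz uz'.
Qed.

End NewLabels.

Lemma extend_network z : ~ D z -> exists lab' F',
  [/\ network (D `|` [set z]) lab' F',
      forall x y, D x -> D y -> lab' x y = lab x y /\ F' x y = F x y,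
      lab' x0 z = a & lab' z y0 = b].
Proof.
move=> nDz; have [p [px py pnew]] := new_labels.
have [lab' [lzz lz lz' lD]] := adjoin_label lab p nDz.
have [F' [net' FD]] := new_network px py pnew nDz lzz lz lz' lD.
exists lab', F'; split=> //.
- by move=> x y Dx Dy; rewrite lD // FD.
- by rewrite lz' // px atom_convK.
- by rewrite lz.
Qed.

End Extension.
End Networks.

(* The point adjoined to witness that [a ; b] contains the label of [(x, y)]
   is the formal term [Node x y a b], so that adjoined points are fresh. *)
Inductive node (A : Type) : Type :=
  | Root
  | Node of node A & node A & A & A.
Arguments Root {A}.

(** * Saturated networks by Zorn's lemma *)

Section Saturation.
Context (L : Type) (G H : binary_structure L).
Local Notation At := (atom G H).
Local Notation bad := (@forbidden L G H).

(** By [dom_node] every adjoined term is the witness that its name announces. Hence a required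
    witness [Node x y a b] is either already present and correct, or fresh. *)
Record term_network := TermNetwork {
  dom : set (node At);
  lab : node At -> node At -> At;
  hom : node At -> node At -> set (G * H);
  networkP : network dom lab hom;
  dom_root : dom Root;
  dom_node : forall x y a b, dom (Node x y a b) ->
    [/\ dom x, dom y, lab x (Node x y a b) = a & lab (Node x y a b) y = b]
}.

Definition extends (M N : term_network) :=
  dom M `<=` dom N /\ forall x y, dom M x -> dom M y ->
    lab N x y = lab M x y /\ hom N x y = hom M x y.

Lemma extends_refl M : extends M M.
Proof. by split. Qed.

Lemma extends_trans M N P : extends M N -> extends N P -> extends M P.
Proof.
move=> [MN eMN] [NP eNP]; split=> [x /MN/NP //|x y Mx My].
by have [-> ->] := eNP _ _ (MN _ Mx) (MN _ My); exact: eMN.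
Qed.

(** The bound is the union, each pair taking its label and homomorphism from a chosen member that
    contains it. Every network condition concerns at most four points, so it can be checked inside a
    single member of the chain. *)
Lemma chain_bound (A : set term_network) (M0 : term_network) : A M0 ->
  total_on A extends -> exists M, forall N, A N -> extends N M.
Proof.
move=> AM0 Atot.
pose D : set (node At) := [set x | exists2 N, A N & dom N x].
have ND N x : A N -> dom N x -> D x by move=> AN Nx; exists N.
have dir2 x y : D x -> D y -> exists N, [/\ A N, dom N x & dom N y].
  move=> [M AM Mx] [N AN Ny]; have [[MN _]|[NM _]] := Atot M N AM AN.
  - by exists N; split=> //; exact: MN.
  - by exists M; split=> //; exact: NM.
have dir4 x y u v : D x -> D y -> D u -> D v ->
    exists N, [/\ A N, dom N x, dom N y, dom N u & dom N v].
  move=> /dir2 /[apply] -[M [AM Mx My]] /dir2 /[apply] -[N [AN Nu Nv]].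
  have [[MN _]|[NM _]] := Atot M N AM AN.
  - by exists N; split=> //; exact: MN.
  - by exists M; split=> //; exact: NM.
have /choice [pick pickP] : forall xy, exists N, D xy.1 -> D xy.2 ->
    [/\ A N, dom N xy.1 & dom N xy.2].
  move=> [x y] /=; have [[/dir2 h /h [N NP]]|nD] := pselect (D x /\ D y).
    by exists N.
  by exists M0 => Dx Dy; case: nD.
pose l x y := lab (pick (x, y)) x y; pose f x y := hom (pick (x, y)) x y.
have lE N x y : A N -> dom N x -> dom N y -> l x y = lab N x y /\ f x y = hom N x y.
  move=> AN Nx Ny; rewrite /l /f.
  have [AM Mx My] := pickP (x, y) (ND _ _ AN Nx) (ND _ _ AN Ny).
  have [[_ /(_ x y)]|[_ /(_ x y)]] := Atot _ _ AM AN.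
  - by move=> /(_ Mx My) [-> ->].
  - by move=> /(_ Nx Ny) [-> ->].
have net : network D l f.
  split; first split.
  - move=> x y Dx Dy; have [N [AN Nx Ny]] := dir2 _ _ Dx Dy.
    have [[h1 _ _] _ _] := networkP N.
    by rewrite (lE _ _ _ AN Nx Ny).1; exact: h1.
  - move=> x y Dx Dy; have [N [AN Nx Ny]] := dir2 _ _ Dx Dy.
    have [[_ hc _] _ _] := networkP N.
    by rewrite (lE _ _ _ AN Nx Ny).1 (lE _ _ _ AN Ny Nx).1; exact: hc.
  - move=> x y w Dx Dy Dw; have [N [AN Nx Ny Nw _]] := dir4 _ _ _ _ Dx Dy Dw Dw.
    have [[_ _ hb] _ _] := networkP N.
    rewrite (lE _ _ _ AN Nx Ny).1 (lE _ _ _ AN Ny Nw).1 (lE _ _ _ AN Nx Nw).1.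
    exact: hb.
  - move=> x y Dx Dy; have [N [AN Nx Ny]] := dir2 _ _ Dx Dy.
    by have [_ hf _] := networkP N; rewrite (lE _ _ _ AN Nx Ny).2; exact: hf.
  - move=> x y u u' i i' Dx Dy Du Du'.
    have [N [AN Nx Ny Nu Nu']] := dir4 _ _ _ _ Dx Dy Du Du'.
    have [_ _ hcoh] := networkP N; rewrite /in_cone.
    rewrite (lE _ _ _ AN Nx Nu).1 (lE _ _ _ AN Nx Nu').1 (lE _ _ _ AN Nu Ny).1.
    rewrite (lE _ _ _ AN Nu' Ny).1 (lE _ _ _ AN Nx Ny).2 (lE _ _ _ AN Nu Nu').1.
    exact: hcoh.
have rootD : D Root by exists M0 => //; exact: dom_root.
have nodeD x y a b : D (Node x y a b) ->
    [/\ D x, D y, l x (Node x y a b) = a & l (Node x y a b) y = b].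
  move=> [N AN Nz]; have [Nx Ny xz zy] := dom_node Nz.
  by split; [exact: ND Nx|exact: ND Ny|
    rewrite (lE _ _ _ AN Nx Nz).1|rewrite (lE _ _ _ AN Nz Ny).1].
exists (TermNetwork net rootD nodeD) => N AN; split=> [x|x y Nx Ny] /=.
  exact: ND.
exact: lE.
Qed.

Hypothesis pair_exists : forall i i' : G, i <> i' ->
  exists j j' : H, partial_homomorphism [set (i, j); (i', j')].
Hypothesis pair_extends : forall (i i' : G) (j j' : H), i <> i' ->
  partial_homomorphism [set (i, j); (i', j')] ->
  exists f : set (G * H), homomorphism f /\ [set (i, j); (i', j')] `<=` f.

Lemma root_network : inhabited term_network.
Proof.
have [f admf] := exists_admissible pair_exists pair_extends.
have net : network [set Root : node At] (fun _ _ => one') (fun _ _ => f).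
  split=> //; last by move=> ? ? u u' ? ? _ _ -> ->.
  by split=> // [x y -> ->|x y w _ _ _ /forbidden_one [/(_ erefl)]].
by constructor; exact: (TermNetwork net).
Qed.

Lemma saturated_network : exists (D : set (node At)) (l : node At -> node At -> At),
  [/\ D !=set0, consistent D l &
      forall x y a b, D x -> D y -> ~ bad a b (l x y) ->
        exists u, [/\ D u, l x u = a & l u y = b]].
Proof.
have [M0] := root_network.
have [||A Atot|M Mmax] := @ZL_preorder _ M0 (fun M N => `[< extends M N >]).
- by move=> M; apply/asboolP; exact: extends_refl.
- move=> M N P /asboolP MN /asboolP NP; apply/asboolP; exact: extends_trans NP.
- have [[M AM]|nA] := pselect (A !=set0); last first.
    by exists M0 => N AN; case: nA; exists N.
  have [|N NP] := @chain_bound A M AM.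
    by move=> s t As At; have [/asboolP|/asboolP] := Atot s t As At; [left|right].
  by exists N => s As; apply/asboolP; exact: NP.
exists (dom M), (lab M); have [cons _ _] := networkP M; split=> //.
  by exists Root; exact: dom_root.
move=> x y a b Mx My ok; pose z := Node x y a b.
have [Mz|nMz] := pselect (dom M z).
  by have [_ _ xz zy] := dom_node Mz; exists z.
apply: contrapT => nw.
have nw' u : dom M u -> lab M x u = a -> lab M u y <> b.
  by move=> Mu xu uy; apply: nw; exists u.
have [l' [f' [net' agree xz zy]]] :=
  extend_network pair_exists pair_extends (networkP M) Mx My ok nw' nMz.
have rootD : (dom M `|` [set z]) Root by left; exact: dom_root.
have nodeD u v c d : (dom M `|` [set z]) (Node u v c d) ->
    [/\ (dom M `|` [set z]) u, (dom M `|` [set z]) v,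
        l' u (Node u v c d) = c & l' (Node u v c d) v = d].
  move=> [Mw|[-> -> -> ->]]; last by split=> //; left.
  have [Mu Mv uw wv] := dom_node Mw.
  by split; [left|left|rewrite (agree _ _ Mu Mw).1|rewrite (agree _ _ Mw Mv).1].
have : extends M (TermNetwork net' rootD nodeD) by split=> //= u; left.
(* Maximality for a preorder: [M] extends its own extension in return, so it contains [z]. *)
move=> /asboolP /Mmax /asboolP [/(_ z)] sub _.
by apply: nMz; apply: sub; right.
Qed.

End Saturation.

(** * From saturated networks to complete representations *)

Section Representations.
Context (L : Type) (G H : binary_structure L).
Local Notation At := (atom G H).
Local Notation bad := (@forbidden L G H).
Local Notation B := (rainbow_algebra G H).

(* The relation [R \; S] first goes through [S]: labels are read from the
   second point to the first. *)
Lemma representation_of_network (T : Type) (D : set T) (l : T -> T -> At) :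
  D !=set0 -> consistent D l ->
  (forall x y a b, D x -> D y -> ~ bad a b (l x y) ->
     exists u, [/\ D u, l x u = a & l u y = b]) ->
  completely_representable B.
Proof.
move=> [r Dr] [h1 hc hb] sat.
pose U := {x : T | D x}.
pose h (X : B) : set (U * U) := [set p | (X : set At) (l (sval p.2) (sval p.1))].
(* Since [one'] lies below [a ; atom_conv a], saturation at the loop [(r, r)] yields an edge of
   every label. This makes [h] injective. *)
have atoms a : exists2 u, D u & l r u = a.
  have [|u [Du ru _]] := sat r r a (atom_conv a) Dr Dr; last by exists u.
  by rewrite (h1 r r Dr Dr).2 // => /forbidden_one [_ _ /(_ erefl)].
have hmono (X Y : B) : h X = h Y -> (X : set At) `<=` Y.
  move=> XY a Xa; have [u Du ru] := atoms a.
  suff: h Y (exist _ u Du, exist _ r Dr) by rewrite /h /= ru.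
  by rewrite -XY /h /= ru.
exists U, h; split; last first.
  move=> S X [ubX lbX].
  (* Suprema of sets of atoms are unions, and [h], being a preimage, commutes with them. *)
  have XE : X = \bigcup_(s in (S : set (set At))) s.
    apply/seteqP; split.
      rewrite -subsetEset; apply: lbX => s Ss.
      by apply/subsetPset => a sa; exists s.
    by move=> a [s Ss sa]; have /subsetPset := ubX _ Ss; apply.
  by rewrite XE; apply/seteqP; split=> p [s Ss sp]; exists s.
split; split.
- by move=> X Y XY; apply/seteqP; split; exact: hmono.
- by [].
- by [].
- by move=> X; apply/seteqP; split=> // p [].
- apply/seteqP; split=> -[[x Dx] [y Dy]] /=.
    move=> /(h1 _ _ Dy Dx).1 yx; subst y.
    by congr exist; exact: Prop_irrelevance.
  by move=> [xy]; exact/(h1 _ _ Dy Dx).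
- move=> X; apply/seteqP; split=> -[[x Dx] [y Dy]] /=.
    by move=> [a Xa /= yxE]; rewrite /h /= (hc y x) // -yxE atom_convK.
  by rewrite /h /= => xy; exists (l x y) => //; rewrite -(hc x y).
- move=> X Y; apply/seteqP; split=> -[[x Dx] [y Dy]] /=.
    move=> [a [b [Xa Yb /sat]]] /(_ Dy Dx) [u [Du yu ux]].
    by exists (exist _ u Du) => /=; rewrite /h /= ?yu ?ux.
  move=> [[u Du] Yux Xyu].
  by exists (l y u), (l u x); split=> //; exact: hb.
Qed.

(** * From complete representations to homomorphisms *)

Section FromRepresentation.
Context (U : Type) (h : B -> set (U * U)).
Hypothesis reph : complete_representation h.

Definition labelled x y (a : At) := h [set a] (y, x).

Lemma rep_mono (X Y : B) : (X : set At) `<=` Y -> h X `<=` h Y.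
Proof.
have [[[_ _ hU _] _] _] := reph.
move=> XY p Xp; have -> : Y = Order.join X Y.
  by rewrite joinEset; apply/esym/setUidPr.
by rewrite hU; left.
Qed.

Lemma labelled_inj x y a b : labelled x y a -> labelled x y b -> a = b.
Proof.
have [[[_ _ _ hC] _] _] := reph.
move=> la lb; apply: contrapT => ab.
have : h (Order.compl ([set a] : B)) (y, x).
  by apply: rep_mono lb; rewrite complEset => _ -> ba; apply: ab.
by rewrite hC => -[_]; apply.
Qed.

(** Completeness enters here: [X] is the supremum of the singletons of its atoms. *)
Lemma rep_labelled (X : B) x y : h X (y, x) ->
  exists2 a, (X : set At) a & labelled x y a.
Proof.
have [_ hsup] := reph.
have sup : supremums [set [set a] | a in (X : set At)] (X : set At).
  split=> [_ [a Xa <-]|Y ubY]; first by apply/subsetPset => _ ->.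
  apply/subsetPset => a Xa.
  by have /ubY/subsetPset : [set [set b] | b in X] [set a]; [exists a|apply].
by rewrite (hsup _ _ sup) => -[_ [a Xa <-] ?]; exists a.
Qed.

Lemma labelled_one x y : labelled x y one' <-> x = y.
Proof.
have [[_ [hI _ _]] _] := reph.
rewrite /labelled; change [set one'] with (ra_id B); rewrite hI.
by split=> [yx|->//]; exact: (esym yx).
Qed.

Lemma labelled_conv x y a : labelled x y a -> labelled y x (atom_conv a).
Proof.
have [[_ [_ hcv _]] _] := reph.
rewrite /labelled => la; have : h (ra_conv ([set a] : B)) (x, y) by rewrite hcv.
by apply: rep_mono => _ [_ -> <-].
Qed.

Lemma labelled_comp x z y a b : labelled x z a -> labelled z y b ->
  exists2 c, labelled x y c & ~ bad a b c.
Proof.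
have [[_ [_ _ hcomp]] _] := reph.
move=> la lb; have : h (ra_comp ([set a] : B) ([set b] : B)) (y, x).
  by rewrite hcomp; exists z.
by move=> /rep_labelled [c [_ [_ [-> -> ?]]] ?]; exists c.
Qed.

Lemma labelled_allowed x z y a b c : labelled x z a -> labelled z y b ->
  labelled x y c -> ~ bad a b c.
Proof.
move=> la lb lc; have [c' lc' ok] := labelled_comp la lb.
by rewrite (labelled_inj lc lc').
Qed.

Lemma labelled_witness x y a b c : labelled x y c -> ~ bad a b c ->
  exists z, labelled x z a /\ labelled z y b.
Proof.
have [[_ [_ _ hcomp]] _] := reph.
move=> lc ok; have : h (ra_comp ([set a] : B) ([set b] : B)) (y, x).
  by apply: rep_mono lc => _ ->; exists a, b.
by rewrite hcomp => -[z /= lb la]; exists z.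
Qed.

Lemma labelled_exists a : exists x y, labelled x y a.
Proof.
have [[[hinj h0 _ _] _] _] := reph.
apply: contrapT => na; have : ([set a] : B) = set0.
  apply: hinj; rewrite [RHS]h0; apply/seteqP; split=> // -[y x] la.
  by apply: na; exists x, y.
by move=> /seteqP [/(_ a erefl)].
Qed.

Lemma green_yellow_witness x y c i : labelled x y c -> c <> one' ->
  exists z, labelled x z (green i) /\ labelled z y yellow.
Proof.
move=> lc c1; apply: labelled_witness lc _ => /forbidden_green_yellow /(_ isT isT).
by case: c c1.
Qed.

Lemma green_yellow_red x y u u' i i' : i <> i' ->
  labelled x u (green i) -> labelled u y yellow ->
  labelled x u' (green i') -> labelled u' y yellow ->
  exists j j', labelled u u' (red j j') /\
    partial_homomorphism [set (i, j); (i', j')].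
Proof.
move=> ii' xu uy xu' uy'.
have [c lc /allowed_green_green [nw ng nr]] := labelled_comp (labelled_conv xu) xu'.
have [c' lc' /allowed_yellow_yellow [ny nb]] :=
  labelled_comp uy (labelled_conv uy').
move: ny nb; rewrite (labelled_inj lc' lc).
case: c nw ng nr lc {lc'} => [||||k|j j'] // nw ng nr lc ny nb.
- move: xu' => /(labelled_inj) xu'E; move: lc => /labelled_one uu'; subst u'.
  by have [] := xu'E _ xu => ii; case: ii'.
- by case: (ng k).
- by exists j, j'; have [_] := nr _ _ erefl.
Qed.

(** The image of [i] is the first index of any red edge leaving [z i]. Red triangles make it
    independent of the edge chosen, and green-green-red triangles over [x] make it a
    homomorphism. *)
Lemma cone_homomorphism x y (z : G -> U) (i0 i1 : G) : i0 <> i1 ->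
  (forall i, labelled x (z i) (green i) /\ labelled (z i) y yellow) ->
  exists f : set (G * H), homomorphism f /\
    forall i i' j j', i <> i' -> labelled (z i) (z i') (red j j') ->
      f (i, j) /\ f (i', j').
Proof.
move=> i01 zP.
have zred i i' : i <> i' -> exists j j', labelled (z i) (z i') (red j j') /\
    partial_homomorphism [set (i, j); (i', j')].
  move=> ii'; have [[xi yi] [xi' yi']] := (zP i, zP i').
  exact: green_yellow_red ii' xi yi xi' yi'.
pose f := [set ij : G * H | exists i' j',
  ij.1 <> i' /\ labelled (z ij.1) (z i') (red ij.2 j')].
have fP i i' j j' : i <> i' -> labelled (z i) (z i') (red j j') ->
    f (i, j) /\ f (i', j').
  move=> ii' lij; split; first by exists i', j'.
  by exists i, j; split; [exact/nesym|exact: labelled_conv lij].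
have f_fun : partial_map f.
  move=> i j j' [k [m [/= ik lk]]] [k' [m' [/= ik' lk']]].
  have [kk'|kk'] := pselect (k = k').
    by subst k'; have [] := labelled_inj lk lk'.
  have [n [n' [ln _]]] := zred _ _ kk'.
  by have [] := allowed_red_red (labelled_allowed lk ln lk').
exists f; split=> //; split; last first.
  (* A red edge at [z i] needs a second index: [i1] for [i0], and [i0] for every other [i]. *)
  move=> i; have [ii0|ii0] := pselect (i = i0).
    have [j [j' [lj _]]] := zred _ _ i01.
    by exists j; rewrite ii0; have [] := fP _ _ _ _ i01 lj.
  have [j [j' [lj _]]] := zred _ _ ii0.
  by exists j; have [] := fP _ _ _ _ ii0 lj.
split=> // b i i' j j' fij fij' ii'.
have [k [k' [lk [_ kP]]]] := zred _ _ ii'.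
have [fik fik'] := fP _ _ _ _ ii' lk.
rewrite (f_fun _ _ _ fij fik) (f_fun _ _ _ fij' fik').
by apply: kP; [left|right|].
Qed.

Lemma representation_pair_exists (i i' : G) : i <> i' ->
  exists j j' : H, partial_homomorphism [set (i, j); (i', j')].
Proof.
(* Any atom other than [one'] would serve as the base of a cone. *)
move=> ii'; have [x [y lxy]] := labelled_exists black.
have [u [xu uy]] := green_yellow_witness i lxy ltac:(by []).
have [u' [xu' uy']] := green_yellow_witness i' lxy ltac:(by []).
have [j [j' [_ P]]] := green_yellow_red ii' xu uy xu' uy'.
by exists j, j'.
Qed.

(** Start from an edge [(u, u')] labelled [red j j'] and build the cone around it: [x] with green
    edges and [y] with yellow edges to both ends. Filling the remaining indices with witnesses over
    [(x, y)] gives a full cone containing the prescribed red edge. *)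
Lemma representation_pair_extends (i i' : G) (j j' : H) : i <> i' ->
  partial_homomorphism [set (i, j); (i', j')] ->
  exists f : set (G * H), homomorphism f /\ [set (i, j); (i', j')] `<=` f.
Proof.
move=> ii' P; have [u [u' luu']] := labelled_exists (red j j').
have [x [ux xu']] : exists x, labelled u x (green i) /\ labelled x u' (green i').
  by apply: labelled_witness luu' _ => /forbidden_green_green_red [].
have [y [uy yu']] : exists y, labelled u y yellow /\ labelled y u' yellow.
  by apply: labelled_witness luu' _ => /forbidden_yellow_yellow_red.
have [c lc ok] := labelled_comp (labelled_conv ux) uy.
(* Label [one'] would make yellow the converse of a green atom. *)
have c1 : c <> one' by move=> cE; move: ok; rewrite cE => /allowed_one.
have zex k : exists z, [/\ k = i -> z = u, k = i' -> z = u',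
    labelled x z (green k) & labelled z y yellow].
  have [->|ki] := pselect (k = i).
    by exists u; split=> //; exact: labelled_conv ux.
  have [->|ki'] := pselect (k = i').
    by exists u'; split=> [/nesym|||] //; exact: labelled_conv yu'.
  by have [z [xz zy]] := green_yellow_witness k lc c1; exists z.
have [z zP] := choice zex.
have [|f [hf fP]] := @cone_homomorphism x y z i i' ii'.
  by move=> k; have [] := zP k.
have [zi _ _ _] := zP i; have [_ zi' _ _] := zP i'.
have [fij fij'] : f (i, j) /\ f (i', j').
  by apply: fP ii' _; rewrite zi // zi'.
by exists f; split=> // _ [|] ->.
Qed.

End FromRepresentation.
End Representations.

Theorem theorem2p1 (L : Type) (G H : binary_structure L) :
  ((forall i i' : G, i <> i' ->
      exists j j' : H, partial_homomorphism [set (i, j); (i', j')]) /\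
   (forall (i i' : G) (j j' : H), i <> i' ->
      partial_homomorphism [set (i, j); (i', j')] ->
      exists f : set (G * H),
        homomorphism f /\ [set (i, j); (i', j')] `<=` f))
  <-> completely_representable (rainbow_algebra G H).
Proof.
split=> [[pair_exists pair_extends]|[U [h reph]]].
- have [D [l [D0 cons sat]]] := saturated_network pair_exists pair_extends.
  exact: representation_of_network D0 cons sat.
- split; first exact: representation_pair_exists reph.
  exact: representation_pair_extends reph.
Qed.
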